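(* The family $\mathbf{f}_c(z)=\sqrt[q]{z^p}+c$ with $(p,q)=(4,2)$ satisfies the transversality condition at every Misiurewicz point $a\in\mathbb{C}$.
   Context: **The correspondence.** For $c\in\mathbb{C}$, $\mathbf{f}_c$ (with $(p,q)=(4,2)$) is the multivalued map with $w\in\mathbf{f}_c(z)$ iff $(w-c)^2=z^4$, i.e. $w=z^2+c$ or $w=-z^2+c$. A forward orbit of $z_0$ under $\mathbf{f}_c$ is a sequence $(z_j)_{j\ge0}$ with $z_{j+1}\in\mathbf{f}_c(z_j)$ for all $j$; it is bounded if it is contained in a compact subset of $\mathbb{C}$. A parameter $a\in\mathbb{C}$ is a Misiurewicz point if the critical point $0$ has a unique bounded forward orbit under $\mathbf{f}_a$ and this orbit is strictly pre-periodic (eventually periodic but not periodic). A univalent branch of $\mathbf{f}_c$ is an injective holomorphic map $f$ with $f(z)\in\mathbf{f}_c(z)$ for all $z$ in its domain. **Setting near a Misiurewicz point $a$.** The point $a$ has a unique bounded forward orbit $z_0=a,z_1,z_2,\dots$ under $\mathbf{f}_a$; it is pre-periodic and no $z_j$ equals $0$. Let $\ell$ be the smallest index such that $z_\ell$ lies on the cycle of this orbit (one has $\ell\ge1$) and $n$ the period, so $z_{j+n}=z_j$ for $j\ge\ell$. For $j\ge1$, $f_j$ is the univalent branch of $\mathbf{f}_a$ defined near $z_{j-1}$ with $f_j(z_{j-1})=z_j$, and $f_{j,c}=f_j+(c-a)$ is the corresponding perturbed branch of $\mathbf{f}_c$. Put $g_c=f_{\ell,c}\circ\cdots\circ f_{1,c}$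 (near $a$) and $h_c=f_{\ell+n,c}\circ\cdots\circ f_{\ell+1,c}$ (near $z_\ell$). **Transversality condition at $a$.** The function $w(c)=h_c(g_c(c))-g_c(c)$, holomorphic near $a$ with $w(a)=0$, satisfies $w'(a)\ne0$. *)

(* Defs.v *)
From mathcomp Require Import all_boot all_order all_algebra complex.
From mathcomp Require Import all_classical all_reals all_analysis.

Set Implicit Arguments.
Unset Strict Implicit.
Unset Printing Implicit Defensive.

Import numFieldNormedType.Exports.
Import Order.TTheory GRing.Theory Num.Theory.

Local Open Scope classical_set_scope.
Local Open Scope ring_scope.

(* The canonical topology and normed module structure that
   numFieldNormedType.Exports puts on every numeric field are found only if the
   carrier is seen as the sort of a numeric field; R[i] alone does not have
   them.  Here the norm is the modulus, and [derivable _ _ 1] and [derive1] are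
   complex differentiability and the complex derivative. *)
Definition Cplx (R : realType) : numClosedFieldType := R[i]%C.

Section Correspondence.
Variables (R : realType) (p q : nat).
Local Notation C := (Cplx R).
Implicit Types (a c x y : C) (z : nat -> C) (U : set C) (f w : C -> C).

(* [corr c x y] is y \in f_c(x), where f_c(x) = x^(p/q) + c is multivalued. *)
Definition corr c x y : Prop := (y - c) ^+ q = x ^+ p.

Definition forward_orbit c x z : Prop :=
  z 0%N = x /\ forall j, corr c (z j) (z j.+1).

Definition bounded_orbit z : Prop :=
  exists K : set C, compact K /\ forall j, K (z j).

Definition bounded_forward_orbit c x z : Prop :=
  forward_orbit c x z /\ bounded_orbit z.

Definition periodic_from z (k n : nat) : Prop :=
  (0 < n)%N /\ forall j, (k <= j)%N -> z (j + n)%N = z j.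

Definition strictly_preperiodic z : Prop :=
  (exists k n, periodic_from z k n) /\ ~ (exists n, periodic_from z 0%N n).

Definition Misiurewicz a : Prop :=
  exists z, unique (bounded_forward_orbit a 0) z /\ strictly_preperiodic z.

(* The set of points of the cycle of an eventually periodic sequence. *)
Definition cycle_of z : set C :=
  [set x | exists k n j, [/\ periodic_from z k n, (k <= j)%N & x = z j]].

Definition preperiod z (l : nat) : Prop :=
  cycle_of z (z l) /\ forall k, cycle_of z (z k) -> (l <= k)%N.

Definition period z (l n : nat) : Prop :=
  periodic_from z l n /\ forall m, periodic_from z l m -> (n <= m)%N.

(* Functions are total; only the restriction of f to U is meaningful. *)
Definition univalent_branch c U f : Prop :=
  [/\ open U, set_inj U f, forall x, U x -> derivable f x 1
    & forall x, U x -> corr c x (f x)].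

Definition branch_near c x y f : Prop :=
  exists U, [/\ U x, univalent_branch c U f & f x = y].

Definition perturb a (f : nat -> C -> C) c (j : nat) : C -> C :=
  fun x => f j x + (c - a).

(* [chain F m k] is F_(m+k) o ... o F_(m+1). *)
Fixpoint chain (F : nat -> C -> C) (m k : nat) : C -> C :=
  if k is k'.+1 then F (m + k'.+1)%N \o chain F m k' else id.

Definition return_defect a (f : nat -> C -> C) (l n : nat) : C -> C :=
  fun c =>
    let g_c := chain (perturb a f c) 0%N l in
    let h_c := chain (perturb a f c) l n in
    h_c (g_c c) - g_c c.

(* The branches f_j are indexed by j >= 1; f 0 is not used.  The germ of f_j at
   z_(j-1) is determined by a and z, so that the quantification over f only
   ranges over the representatives of these germs. *)
Definition transversality a : Prop :=
  forall z (l n : nat) (f : nat -> C -> C),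
    unique (bounded_forward_orbit a a) z ->
    preperiod z l -> period z l n ->
    (forall j, branch_near a (z j) (z j.+1) (f j.+1)) ->
    let w := return_defect a f l n in
    [/\ \forall c \near a, derivable w c 1, w a = 0 & derive1 w a != 0].

End Correspondence.

(* Main.v *)
(* Write Z_k for the orbit of the critical point 0 along the branches, as
   polynomials in c: Z_0 = 0 and Z_(k+1) = e_k Z_k^2 + c with e_k = 1 or -1, so
   that Z_(k+1)(a) = z_k.  With D_k = Z_k'(a) one has D_(k+1) = 1 + 2 e_k Z_k D_k.
   The relation Z_(l+1) = Z_(l+n+1) at c = a makes a an algebraic integer, and
   w'(a) = D_(l+n+1) - D_(l+1).  Suppose that w'(a) = 0 and compare modulo 2 in
   the ring of algebraic integers, where D_k = 1 for k >= 1.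
   - If e_l = e_(l+n), then Z_(l+n) = - Z_l, hence D_l + D_(l+n) = 0.  Halving
     this gives e_(l-1) Z_(l-1) + e_(l+n-1) Z_(l+n-1) = 1 mod 2, but the square
     of the left-hand side is Z_l + Z_(l+n) = 0 mod 2.
   - Otherwise Z_(l+n) = u Z_l with u^2 = -1, and D_l + u D_(l+n) = 0.  Then
     2 divides 1 + u, so 4 divides (1 + u)^2 = 2 u and 2 divides the unit u.
   Both cases make 1/2 an algebraic integer. *)
Require Import Defs.
From mathcomp Require Import all_boot all_order all_algebra complex.
From mathcomp Require Import all_classical all_reals all_analysis.
From mathcomp Require Import ring zify.

Set Implicit Arguments.
Unset Strict Implicit.
Unset Printing Implicit Defensive.

Import numFieldNormedType.Exports.
Import Order.TTheory GRing.Theory Num.Theory.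

Local Open Scope classical_set_scope.
Local Open Scope ring_scope.

(** * Algebraic integers: one half is not among them *)

Ltac integrality := repeat first
  [ assumption | exact: integral1 | exact: integral_nat | apply: integral_add
  | apply: integral_opp | apply: integral_mul ].

Section Integrality.
Variable K : numFieldType.
Local Notation integral := (integralOver (intr : int -> K)).

(** Clearing denominators at x = 1/2 turns the value of a nonzero integer polynomial into an integer
    congruent to its leading coefficient mod 2; for a monic one it is odd, hence nonzero. *)
Lemma integral_half_contra (x : K) : integral x -> 1 = 2 * x -> False.
Proof.
case=> p /monicP p_monic /rootP px0 x_half.
have ev (q : {poly int}) : q != 0 -> exists k : int,
    2 ^+ (size q).-1 * (map_poly intr q).[x] = (lead_coef q + 2 * k)%:~R :> K.
  elim/poly_ind: q => [|q c IH]; first by rewrite eqxx.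
  have [->|q0] := eqVneq q 0.
    move=> _; exists 0; rewrite mul0r add0r lead_coefC mulr0 addr0.
    by rewrite map_polyC hornerC size_polyC; case: eqP => _; rewrite mul1r.
  move=> _; have [k Ek] := IH q0; exists (k + 2 ^+ (size q).-1 * c).
  have sq : size q = (size q).-1.+1 by rewrite prednK ?size_poly_gt0.
  rewrite lead_coefDl ?lead_coefMX; last first.
    by rewrite size_mulX // size_polyC sq; case: (c != 0).
  rewrite size_MXaddC (negPf q0) [_.+1.-1]/= [X in 2 ^+ X]sq exprS.
  rewrite rmorphD rmorphM /= map_polyX.
  rewrite map_polyC hornerMXaddC [2 * (k + _)]mulrDr addrA rmorphD /= -Ek.
  rewrite !rmorphM rmorphXn /=; set A := _ * _.[x] in Ek *.
  by rewrite -(mulr1 A) [in A * _]x_half /A; ring.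
have p0 : p != 0 by rewrite -lead_coef_eq0 p_monic oner_eq0.
have [k] := ev _ p0; rewrite px0 mulr0 p_monic => /esym/eqP.
by rewrite intr_eq0; lia.
Qed.

Lemma integral_sign (b : bool) : integral ((-1) ^+ b).
Proof. by rewrite -(rmorph_sign intr); exact: integral_id. Qed.

End Integrality.

(** * Critical orbit polynomials for a given sequence of signs *)

Fixpoint crit (s : nat -> bool) (k : nat) : {poly int} :=
  if k is j.+1 then (-1) ^+ s j *: crit s j ^+ 2 + 'X else 0.

(** Since the degrees increase strictly and the leading coefficients are 1 or -1, a coincidence of
    two orbit points makes [a] a root of a polynomial that is monic up to sign. *)
Lemma crit_lead s k :
  size (crit s k.+1) = (2 ^ k).+1 /\ `|lead_coef (crit s k.+1)| = 1.
Proof.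
elim: k => [|k [sz lc]].
  by rewrite /= expr2 mul0r scaler0 add0r size_polyX lead_coefX.
have c0 : crit s k.+1 != 0 by rewrite -size_poly_eq0 sz.
have sq : size ((-1) ^+ s k.+1 *: crit s k.+1 ^+ 2) = (2 ^ k.+1).+1.
  rewrite size_scale ?signr_eq0 // polySpred ?expf_neq0 //.
  by rewrite size_exp sz /= mulnC -expnS.
have sX : (size ('X : {poly int}) <
           size ((-1) ^+ s k.+1 *: crit s k.+1 ^+ 2))%N.
  by rewrite size_polyX sq ltnS -[X in (X < _)%N](expn0 2) ltn_exp2l.
rewrite [crit _ _.+2]/= size_polyDl // lead_coefDl //; split => //.
by rewrite lead_coefZ lead_coef_exp normrM normr_sign normrX lc expr1n mulr1.
Qed.

Section CriticalOrbit.
Variables (K : numFieldType) (s : nat -> bool) (a : K).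
Local Notation integral := (integralOver (intr : int -> K)).
Local Notation P k := (map_poly (intr : int -> K) (crit s k)).
Local Notation Z k := (P k).[a].
Local Notation D k := (P k)^`().[a].
Local Notation e k := ((-1) ^+ s k : K).

Lemma critS k : P k.+1 = e k *: P k ^+ 2 + 'X.
Proof. by rewrite /= rmorphD /= map_polyX map_polyZ rmorph_sign rmorphXn. Qed.

Lemma critZS k : Z k.+1 = e k * Z k ^+ 2 + a.
Proof. by rewrite critS !hornerE. Qed.

Lemma critDS k : D k.+1 = 1 + 2 * (e k * (Z k * D k)).
Proof.
rewrite critS derivD derivZ derivX deriv_exp !hornerE /=.
by rewrite -mulr_natl; ring.
Qed.

Lemma integral_param i j : (i < j)%N -> Z i.+1 = Z j.+1 -> integral a.
Proof.
move=> ij Zij; have [si _] := crit_lead s i; have [sj lj] := crit_lead s j.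
set lc := lead_coef (crit s j.+1) in lj *.
exists (lc *: (crit s j.+1 - crit s i.+1)).
  rewrite monicE lead_coefZ lead_coefDl ?size_polyN ?si ?sj.
    by rewrite -/lc -expr2 -real_normK ?num_real // lj expr1n.
  by rewrite ltnS ltn_exp2l.
by rewrite /root map_polyZ rmorphB hornerZ hornerD hornerN Zij subrr mulr0.
Qed.

(** * Congruences modulo 2 at an integral parameter *)

Hypothesis a_int : integral a.

Lemma integral_orbit k : integral (Z k).
Proof.
elim: k => [|k IH]; first by rewrite rmorph0 horner0; exact: mxpoly.integral0.
rewrite critZS; apply: integral_add => //; apply: integral_mul.
  exact: integral_sign.
by rewrite expr2; apply: integral_mul.
Qed.

Lemma derivS_odd k : exists2 x, integral x & D k.+1 = 1 + 2 * x.
Proof.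
exists (e k * (Z k * D k)); last exact: critDS.
apply: integral_mul; first exact: integral_sign.
apply: integral_mul; first exact: integral_orbit.
elim: k => [|k IH].
  by rewrite rmorph0 deriv0 horner0; exact: mxpoly.integral0.
rewrite critDS; integrality; [exact: integral_sign | exact: integral_orbit].
Qed.

(** [D 0] is 0 and not odd, but [Z 0] is 0 as well; multiplying by [Z k] gives a congruence that
    holds from index 0 on. *)
Lemma orbit_deriv_mod2 k : exists2 t, integral t & Z k * D k = Z k + 2 * t.
Proof.
case: k => [|k].
  exists 0; first exact: mxpoly.integral0.
  by rewrite rmorph0 horner0 mul0r mulr0 addr0.
have [x x_int ->] := derivS_odd k.
exists (Z k.+1 * x); last by ring.
by apply: integral_mul => //; exact: integral_orbit.
Qed.

Lemma crit_transverse_same i j : s i = s j -> Z i.+1 = Z j.+1 ->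
  Z i != Z j -> Z i != 0 -> D i.+1 != D j.+1.
Proof.
move=> sij Zij1 Zij Zi0.
have sgn0 (b : bool) : (-1) ^+ b != 0 :> K by rewrite signr_eq0.
have Zji : Z j = - Z i.
  have /eqP : Z i ^+ 2 = Z j ^+ 2.
    apply: (mulfI (sgn0 (s i))).
    by move: Zij1; rewrite !critZS sij => /addIr.
  by rewrite eqf_sqr (negPf Zij) => /eqP->; rewrite opprK.
apply/eqP; rewrite !critDS sij => /addrI/(mulfI _).
rewrite pnatr_eq0 => /(_ isT)/(mulfI (sgn0 _)).
rewrite Zji mulNr -mulrN => /(mulfI Zi0) Dij.
(* Both indices are positive because [Z 0] is 0. From here on [i] and [j] denote the predecessors,
   whose signs [s i] and [s j] may differ. *)
case: i j => [|i] [|j] in sij Zij1 Zij Zi0 Zji Dij *.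
- by rewrite rmorph0 horner0 eqxx in Zi0.
- by rewrite rmorph0 horner0 eqxx in Zi0.
- by move/eqP: Zji; rewrite rmorph0 horner0 eq_sym oppr_eq0 (negPf Zi0).
have [t t_int Et] := orbit_deriv_mod2 i.
have [r r_int Er] := orbit_deriv_mod2 j.
have Zi_int := integral_orbit i; have Zi1_int := integral_orbit i.+1.
have Zj_int := integral_orbit j.
have ei_int := integral_sign K (s i); have ej_int := integral_sign K (s j).
pose u := e i * Z i + e j * Z j; pose T := e i * t + e j * r.
have Eu : u = - (1 + 2 * T).
  apply: (mulfI (_ : 2 != 0)); first by rewrite pnatr_eq0.
  move: Dij; rewrite !critDS Et Er /u /T => /eqP; rewrite -subr_eq0 => /eqP H.
  by apply/eqP; rewrite -subr_eq0 -H; apply/eqP; ring.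
(* [V] is half of u^2: each square is e (Z_next - a), with Z_next equal to [Z i.+1] or its opposite,
   and writing each sign as 1 - 2b makes the sum visibly even. *)
pose V := ((s j)%:R - (s i)%:R) * Z i.+1
    - (1 - (s i)%:R - (s j)%:R) * a + e i * Z i * (e j * Z j).
have Eu2 : u * u = 2 * V.
  have sq (b : bool) (x : K) : (-1) ^+ b * x * ((-1) ^+ b * x) = x ^+ 2.
    by rewrite mulrACA -!expr2 sqrr_sign mul1r.
  have sgn (b : bool) : (-1) ^+ b = 1 - 2 * b%:R :> K.
    by rewrite signrE -mul2n natrM.
  have Si : Z i ^+ 2 = e i * (Z i.+1 - a).
    by rewrite critZS addrK mulrA -expr2 sqrr_sign mul1r.
  have Sj : Z j ^+ 2 = e j * (- Z i.+1 - a).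
    by rewrite -Zji critZS addrK mulrA -expr2 sqrr_sign mul1r.
  have -> : u * u = Z i ^+ 2 + Z j ^+ 2 + 2 * (e i * Z i * (e j * Z j)).
    by rewrite -(sq (s i) (Z i)) -(sq (s j) (Z j)) /u; ring.
  rewrite Si Sj [X in X * (_ - a) + _]sgn [X in _ + X * (- _ - a) + _]sgn /V.
  by ring.
(* This is (1 + 2T)^2 = 2V solved for 1. *)
apply: (@integral_half_contra _ (V - 2 * T - 2 * (T * T))).
  by rewrite /V /T; integrality.
rewrite Eu in Eu2.
by rewrite 2!mulrBr -Eu2; ring.
Qed.

Lemma crit_transverse_opp i j : s i != s j -> Z i.+1 = Z j.+1 ->
  Z i != 0 -> D i.+1 != D j.+1.
Proof.
move=> sij Zij1 Zi0.
have sgn0 (b : bool) : (-1) ^+ b != 0 :> K by rewrite signr_eq0.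
have eij : e i = - e j.
  rewrite -signrN; congr (_ ^+ nat_of_bool _).
  by case: (s i) (s j) sij => [] [].
have Zij : Z j ^+ 2 = - Z i ^+ 2.
  apply: (mulfI (sgn0 (s j))).
  by move: Zij1; rewrite !critZS eij mulrN mulNr => /addIr.
apply/eqP; rewrite !critDS eij => /addrI/(mulfI _).
rewrite pnatr_eq0 => /(_ isT); rewrite mulNr -mulrN => /(mulfI (sgn0 _)).
pose w := Z j / Z i.
have Zjw : Z j = Z i * w by rewrite /w mulrCA divff ?mulr1.
have w2 : w * w = - 1.
  by rewrite -expr2 /w expr_div_n Zij mulNr divff // expf_neq0.
have w_int : integral w.
  exists ('X^2 - (-1)%:P); first exact: monicXnsubC.
  rewrite /root rmorphB /= map_polyXn map_polyC !hornerE expr2 w2.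
  by apply/eqP; exact: subrr.
rewrite {1}Zjw -mulrN -mulrA => /(mulfI Zi0).
case: i j => [|i] [|j] in sij Zij1 Zi0 eij Zij w Zjw w2 w_int *.
- by rewrite rmorph0 horner0 eqxx in Zi0.
- by rewrite rmorph0 horner0 eqxx in Zi0.
- move/eqP: Zij; rewrite rmorph0 horner0 expr0n eq_sym oppr_eq0.
  by rewrite sqrf_eq0 (negPf Zi0).
have [x x_int ->] := derivS_odd i; have [y y_int ->] := derivS_odd j => H.
pose v := - (x + w * y).
(* The cancelled equation reads -(1 + 2x) = w (1 + 2y). *)
have Ev : 1 + w = 2 * v.
  move/eqP: H; rewrite eq_sym -subr_eq0 => /eqP H.
  by apply/eqP; rewrite -subr_eq0 -H /v; apply/eqP; ring.
have Ew : w = 2 * (v * v).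
  apply: (mulfI (_ : 2 != 0)); first by rewrite pnatr_eq0.
  have -> : 2 * w = (1 + w) * (1 + w) - (1 + w * w) by ring.
  by rewrite w2 Ev; ring.
(* Squaring w = 2 v^2 gives -1 = 4 v^4. *)
apply: (@integral_half_contra _ (- (2 * ((v * v) * (v * v))))).
  by rewrite /v; integrality.
by rewrite -[LHS]opprK -w2 {1 2}Ew; ring.
Qed.

Lemma crit_transverse i j : Z i.+1 = Z j.+1 ->
  Z i != Z j -> Z i != 0 -> D i.+1 != D j.+1.
Proof.
have [sij|sij] := eqVneq (s i) (s j).
  exact: crit_transverse_same.
by move=> H _; exact: crit_transverse_opp.
Qed.

End CriticalOrbit.

(** * From germs of branches to polynomials in the parameter *)

Lemma is_derive_horner (K : numFieldType) (p : {poly K}) (x : K) :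
  is_derive x (1 : K) (horner p : K -> K) p^`().[x].
Proof.
elim/poly_ind: p => [|p c IH].
  rewrite deriv0 horner0.
  have -> : horner (0 : {poly K}) = cst 0 by apply/funext => y; rewrite horner0.
  exact: is_derive_cst.
have -> : horner (p * 'X + c%:P) = horner p * id + cst c.
  by apply/funext => y; rewrite hornerMXaddC.
rewrite derivMXaddC hornerD hornerMX.
have H := is_deriveD (is_deriveM IH (is_derive_id x (1 : K)))
  (is_derive_cst c x (1 : K)).
apply: (is_derive_eq H).
by rewrite addr0 -![_ *: _]/(_ * _) mulr1 [_ * x]mulrC.
Qed.

Lemma continuous_add_horner (K : numFieldType) (f : K -> K) (q : {poly K})
    (x : K) :
  derivable f x 1 -> {for x, continuous (fun t => f t + q.[t])}.
Proof.
move=> /derivableP df.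
apply/differentiable_continuous/derivable1_diffP.
exact: (@ex_derive _ _ _ _ _ _ _ (is_deriveD df (is_derive_horner q x))).
Qed.

Section Germs.
Variable R : realType.
Local Notation C := (Cplx R).
Implicit Types (a x y : C) (z : nat -> C).

(** A priori the sign depends on the point. With [b] the sign at [x], the function f(t) - a + (-1)^b
    t^2 is continuous at [x], vanishes wherever the other sign occurs, and equals 2 (-1)^b x^2,
    which is not 0, at [x]. *)
Lemma branch_near_square a x y (f : C -> C) : x != 0 ->
  branch_near 4 2 a x y f ->
  exists b : bool, \forall t \near x, f t = (-1) ^+ b * t ^+ 2 + a.
Proof.
move=> x0 [U [Ux [Uop _ Uder Ucorr] _]].
have sqE t : U t -> exists b : bool, f t = (-1) ^+ b * t ^+ 2 + a.
  move=> /Ucorr; rewrite /corr -[4%N]/(2 * 2)%N exprM => /eqP.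
  rewrite eqf_sqr => /orP[] /eqP H; [exists false | exists true].
    by rewrite expr0 mul1r -H subrK.
  by rewrite expr1 mulN1r -H subrK.
have [b fx] := sqE _ Ux; exists b.
pose q : {poly C} := (-1) ^+ b *: 'X^2 - a%:P.
have qE t : f t + q.[t] = f t - a + (-1) ^+ b * t ^+ 2.
  by rewrite /q hornerD hornerN hornerC hornerZ hornerXn addrA addrAC.
pose d t := f t + q.[t].
have dcont : {for x, continuous d} :=
  continuous_add_horner (q := q) (Uder x Ux).
have dx : d x != 0.
  rewrite /d qE fx addrK -mulr2n -mulr_natl.
  by rewrite !mulf_neq0 ?pnatr_eq0 ?signr_eq0 ?expf_neq0.
have d0 : \forall t \near x, d t != 0 by exact: (cvgr_neq0 _ dcont dx).
have Unear : \forall t \near x, U t by apply: open_nbhs_nbhs.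
near=> t.
have dt : d t != 0 by near: t.
have [b' ft] : exists b : bool, f t = (-1) ^+ b * t ^+ 2 + a.
  by apply: sqE; near: t.
have [<- //|bb'] := eqVneq b' b.
have b'E : b' = ~~ b by case: (b') (b) bb' => [] [].
by case/eqP: dt; rewrite /d qE ft addrK -mulrDl b'E signrN addNr mul0r.
Unshelve. all: by end_near. Qed.

Lemma chain_add (F : nat -> C -> C) l n x :
  chain F l n (chain F 0 l x) = chain F 0 (l + n)%N x.
Proof. by elim: n => [|n IH]; rewrite ?addn0 // addnS /= IH add0n addnS. Qed.

Lemma bounded_forward_orbit_shift p q a x y z j :
  z j = x -> bounded_forward_orbit p q a y z ->
  bounded_forward_orbit p q a x (fun i => z (j + i)%N).
Proof.
move=> zj [[_ zS] [A [Acpt zA]]]; split; last by exists A.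
by split=> [|i]; rewrite ?addn0 ?addnS.
Qed.

Lemma bounded_forward_orbit_cons p q a z : (0 < p)%N -> (0 < q)%N ->
  bounded_forward_orbit p q a a z ->
  bounded_forward_orbit p q a 0 (fun i => if i is j.+1 then z j else 0).
Proof.
move=> p0 q0 [[z0 zS] [A [Acpt zA]]]; split.
  split=> // -[|j] //.
  by rewrite /corr z0 subrr !expr0n (gtn_eqF p0) (gtn_eqF q0).
exists (A `|` [set 0]); split; last by move=> [|j]; [right | left].
by apply: compactU => //; exact: compact_set1.
Qed.

(** If z_j = 0, the tail of [z] from j and the sequence 0, z_0, z_1, ... are both bounded orbits of
    0. By uniqueness they coincide, so the critical orbit has period j + 1. *)
Lemma Misiurewicz_orbit_neq0 p q a z : (0 < p)%N -> (0 < q)%N ->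
  Misiurewicz p q a -> bounded_forward_orbit p q a a z -> forall j, z j != 0.
Proof.
move=> p0 q0 [y [[_ y_uniq] [_ y_aper]]] zorb j; apply/eqP => zj; apply: y_aper.
have yE := y_uniq _ (bounded_forward_orbit_cons p0 q0 zorb).
have yE' := y_uniq _ (bounded_forward_orbit_shift zj zorb).
exists j.+1; split=> // i _.
by rewrite {1}yE addnS yE' addnC.
Qed.

Section Itinerary.
Variables (a : C) (z : nat -> C) (f : nat -> C -> C) (s : nat -> bool).
Local Notation P k := (map_poly (intr : int -> C) (crit s k)).
Hypotheses (z0 : z 0%N = a)
  (fz : forall j, f j.+1 (z j) = z j.+1)
  (fs : forall j, \forall t \near z j, f j.+1 t = (-1) ^+ s j.+1 * t ^+ 2 + a).

Lemma crit_itinerary k : (P k.+1).[a] = z k.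
Proof.
elim: k => [|k IH]; rewrite critZS.
  by rewrite rmorph0 horner0 expr0n mulr0 add0r z0.
by rewrite IH -fz (nbhs_singleton (fs k)).
Qed.

(** Adding c - a turns each signed square plus [a] into the same signed square plus [c]; by
    continuity the point P_(k+1)(c) stays where the formula for f_(k+1) is valid. *)
Lemma chain_crit_near k :
  \forall c \near a, chain (perturb a f c) 0 k c = (P k.+1).[c].
Proof.
elim: k => [|k IH].
  by near=> c; rewrite critS rmorph0 expr0n scaler0 add0r hornerX.
have Pcont : {for a, continuous (horner (P k.+1) : C -> C)}.
  apply/differentiable_continuous/derivable1_diffP.
  exact: (@ex_derive _ _ _ _ _ _ _ (is_derive_horner _ _)).
have fP : \forall c \near a, f k.+1 (P k.+1).[c] =
    (-1) ^+ s k.+1 * (P k.+1).[c] ^+ 2 + a.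
  by have := fs k; rewrite -crit_itinerary => /Pcont.
near=> c.
rewrite [LHS]/= add0n /perturb.
have -> : chain (perturb a f c) 0 k c = (P k.+1).[c].
  by near: c.
have -> : f k.+1 (P k.+1).[c] = (-1) ^+ s k.+1 * (P k.+1).[c] ^+ 2 + a.
  by near: c.
by rewrite [RHS]critZS -addrA (addrC a) subrK.
Unshelve. all: by end_near. Qed.

End Itinerary.

End Germs.

Theorem theorem3p1 (R : realType) (a : Cplx R) :
  Misiurewicz 4 2 a -> transversality 4 2 a.
Proof.
move=> a_mis z l n f [z_orb _] [_ l_min] [[n0 z_per] _] f_br w.
have z_neq0 := @Misiurewicz_orbit_neq0 R 4 2 a z isT isT a_mis z_orb.
have z0 : z 0%N = a := z_orb.1.1.
have fz j : f j.+1 (z j) = z j.+1 by have [U []] := f_br j.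
(* If l = 0, then z_n = z_0 = a, so z_(n-1)^4 = (a - a)^2 = 0. *)
have l0 : (0 < l)%N.
  rewrite lt0n; apply/eqP => l0; rewrite l0 in z_per.
  have := z_orb.1.2 n.-1; rewrite prednK // -[n]add0n z_per // z0 /corr subrr.
  rewrite expr0n /= => /esym/eqP; rewrite expf_eq0 /=; exact/negP.
(* Otherwise z_(l-1) would already lie on the cycle, against the minimality of [l]. *)
have z_pre : z l.-1 != z (l + n).-1.
  apply/eqP => zl; suff : (l <= l.-1)%N by rewrite leqNgt ltn_predL l0.
  apply: l_min; exists l.-1, n, l.-1; split => //; split => // j.
  rewrite leq_eqVlt => /predU1P[<-|].
    by rewrite zl; congr z; lia.
  by rewrite prednK // => /z_per.
have [s0 fs0] := choice (fun j => branch_near_square (z_neq0 j) (f_br j)).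
(* Shift by one: [s0 j] is the sign of f_(j+1), and [s k] that of f_k. *)
pose s k := s0 k.-1.
have fs j : \forall t \near z j, f j.+1 t = (-1) ^+ s j.+1 * t ^+ 2 + a.
  exact: fs0.
pose P k := map_poly (intr : int -> Cplx R) (crit s k).
have PE k : (P k.+1).[a] = z k := crit_itinerary z0 fz fs k.
have zln : z l = z (l + n)%N by rewrite z_per.
pose Q := P (l + n).+1 - P l.+1.
have wQ : \forall c \near a, w c = Q.[c].
  near=> c; rewrite /w /return_defect chain_add /Q hornerD hornerN.
  by congr (_ - _); near: c; exact: (chain_crit_near z0 fz fs).
have Qw : {near a, (horner Q : Cplx R -> Cplx R) =1 w}.
  by near=> c; apply/esym; near: c.
have Z_eq : (P l.+1).[a] = (P (l + n).+1).[a] by rewrite !PE.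
have l_lt : (l < l + n)%N by rewrite -addn1 leq_add2l.
have a_int : integralOver (intr : int -> Cplx R) a := integral_param l_lt Z_eq.
have Z_neq : (P l).[a] != (P (l + n)%N).[a].
  by rewrite -(prednK l0) addSn !PE -[X in _ != z X]/(l.-1.+1 + n).-1 prednK.
have Z_neq0 : (P l).[a] != 0 by rewrite -(prednK l0) PE.
split.
(* Derivability at each c near [a] requires w = Q on a neighbourhood of that c, not only at c. *)
- have := near_join wQ; apply: filterS => c wQc.
  apply: (near_eq_derivable (f := horner Q)).
    by apply: filterS wQc => t ->.
  exact: (@ex_derive _ _ _ _ _ _ _ (is_derive_horner _ _)).
- by rewrite (nbhs_singleton wQ) /Q hornerD hornerN !PE zln subrr.
- rewrite derive1E (near_eq_derive (g := horner Q)) //.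
  rewrite (@derive_val _ _ _ _ _ _ _ (is_derive_horner _ _)).
  rewrite /Q derivB hornerD hornerN subr_eq0 eq_sym.
  exact: (crit_transverse a_int Z_eq Z_neq Z_neq0).
Unshelve. all: by end_near. Qed.
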